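(* Let $G$ be a connected finite simple undirected graph with $n\ge2$ vertices, and let $0=\lambda_1<\lambda_2\le\lambda_3\le\dots\le\lambda_n$ be the spectrum (with multiplicity) of its Laplacian matrix. Then for every vertex $i$ of $G$, $$\hat\xi_i\ge\frac{\lambda_2}{n},\qquad\text{and}\qquad \hat\Xi(G)\ge\frac{\lambda_2}{n}.$$
   Context: Let $V$ be the vertex set of $G$, $|V|=n$. $\mathcal N(i)$ is the set of neighbors of $i$ (not containing $i$), $d_i=|\mathcal N(i)|$. For disjoint $H,K\subset V$, $|E(H,K)|$ is the number of edges with one end in $H$ and the other in $K$. The normalized ksi-centrality of $i$ is $\hat\xi_i=\frac{|E(\mathcal N(i),V\setminus\mathcal N(i))|}{d_i(n-d_i)}$ (here $d_i\ge1$ for all $i$ since $G$ is connected with $n\ge2$; note $i\in V\setminus\mathcal N(i)$). The average normalized ksi-coefficient is $\hat\Xi(G)=\frac1n\sum_{i\in V}\hat\xi_i$. The Laplacian matrix is $L=D-A$, with $D$ the diagonal degree matrix and $A$ the adjacency matrix. *)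

(* Defs.v *)
From mathcomp Require Import all_boot all_order all_algebra.

Set Implicit Arguments.
Unset Strict Implicit.
Unset Printing Implicit Defensive.

Import Order.TTheory GRing.Theory Num.Theory.
Local Open Scope ring_scope.

(* A finite simple undirected graph is a symmetric irreflexive
   relation e on a finType V; symmetry and irreflexivity are assumed where the
   definitions below are used. *)

Definition connected_graph (V : finType) (e : rel V) : Prop :=
  forall x y : V, connect e x y.

Definition neighbors (V : finType) (e : rel V) (i : V) : {set V} :=
  [set j | e i j].

Definition degree (V : finType) (e : rel V) (i : V) : nat :=
  #|neighbors e i|.

(* Unordered pairs; irreflexivity of e excludes the degenerate [set x; x]. *)
Definition edges (V : finType) (e : rel V) : {set {set V}} :=
  [set f : {set V} | [exists x, exists y, e x y && (f == [set x; y])]].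

Definition edges_between (V : finType) (e : rel V) (H K : {set V}) :
    {set {set V}} :=
  [set f in edges e | [exists x in H, exists y in K, f == [set x; y]]].

Definition norm_ksi (R : rcfType) (V : finType) (e : rel V) (i : V) : R :=
  #|edges_between e (neighbors e i) (~: neighbors e i)|%:R
    / ((degree e i)%:R * (#|V|%:R - (degree e i)%:R)).

Definition avg_norm_ksi (R : rcfType) (V : finType) (e : rel V) : R :=
  (#|V|%:R)^-1 * \sum_(i : V) norm_ksi R e i.

(* Rows and columns are indexed by 'I_#|V| through the enumeration of V. *)
Definition adjacency_mx (R : rcfType) (V : finType) (e : rel V) :
    'M[R]_#|V| :=
  \matrix_(i, j) (e (enum_val i) (enum_val j))%:R.

Definition degree_mx (R : rcfType) (V : finType) (e : rel V) : 'M[R]_#|V| :=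
  diag_mx (\row_i (degree e (enum_val i))%:R).

Definition laplacian_mx (R : rcfType) (V : finType) (e : rel V) :
    'M[R]_#|V| :=
  degree_mx R e - adjacency_mx R e.

(* s lists the eigenvalues of A in nondecreasing order, repeated according to
   (algebraic) multiplicity; in particular size s = n. *)
Definition sorted_spectrum (R : rcfType) (n : nat) (A : 'M[R]_n) (s : seq R) :
    Prop :=
  sorted <=%R s /\ char_poly A = \prod_(a <- s) ('X - a%:P).

(* Main.v *)
(* Let [S] be the neighborhood of [i], of size [d], and write [1_S] for its
   indicator vector. Since [L] kills constants, a combination
   [u = a 1 + b 1_S] satisfies [u L u^* = |b|^2 |E(S, ~: S)|], while
   [|u|^2 >= |b|^2 d (n - d) / n]. By the Courant-Fischer argument some nonzero
   [u] in this plane has [u L u^* >= lambda_2 |u|^2], which is the bound. The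
   spectral theorem is available over closed fields only, so [L] is
   diagonalized over [R[i]], with complex [a] and [b]. *)
Require Import Defs.
From mathcomp Require Import all_boot all_order all_algebra.
From mathcomp Require Import complex ring.

Import Order.TTheory GRing.Theory Num.Theory.
Set Implicit Arguments.
Unset Strict Implicit.
Local Open Scope ring_scope.
Local Open Scope sesquilinear_scope.

Lemma char_poly_similar (F : fieldType) (n : nat) (P A : 'M[F]_n) :
  P \in unitmx -> char_poly (invmx P *m A *m P) = char_poly A.
Proof.
move=> Pu; rewrite /char_poly.
have -> : char_poly_mx (invmx P *m A *m P) =
   map_mx polyC (invmx P) *m char_poly_mx A *m map_mx polyC P.
  rewrite /char_poly_mx mulmxBr mulmxBl -!map_mxM; congr (_ - _).
  by rewrite scalar_mxC -mulmxA -map_mxM mulVmx // map_mx1 mulmx1.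
by rewrite !det_mulmx mulrAC -det_mulmx -map_mxM mulVmx // map_mx1 det1 mul1r.
Qed.

Lemma char_poly_diag (F : fieldType) (n : nat) (D : 'rV[F]_n) :
  char_poly (diag_mx D) = \prod_(i < n) ('X - (D 0 i)%:P).
Proof.
rewrite char_poly_trig ?diag_mx_is_trig //.
by apply: eq_bigr => i _; rewrite mxE eqxx.
Qed.

Lemma spectral_diag_second_le {C : numClosedFieldType} {n : nat} (A : 'M[C]_n)
    (s : seq C) : A \is normalmx -> (1 < n)%N -> sorted <=%R s ->
    char_poly A = \prod_(a <- s) ('X - a%:P) ->
  exists i0, forall j, j != i0 -> s`_1 <= spectral_diag A 0 j.
Proof.
move=> /orthomx_spectralP AE n1 ss; set D := spectral_diag A in AE *.
rewrite [in char_poly A]AE char_poly_similar ?spectral_unit // char_poly_diag => cp.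
have ps : perm_eq [seq D 0 j | j <- enum 'I_n] s.
  by apply: prod_XsubC_eq; rewrite big_map big_enum.
case: s ss ps {cp} => [|s0 s] ss ps.
  by move/perm_size: ps; rewrite size_map size_enum_ord => n0; rewrite n0 in n1.
have /mapP[i0 _ s0E] : s0 \in [seq D 0 j | j <- enum 'I_n].
  by rewrite (perm_mem ps) mem_head.
exists i0 => j ji0.
have {}ps : perm_eq [seq D 0 j | j <- rem i0 (enum 'I_n)] s.
  rewrite -(perm_cons s0) -(permPr ps) s0E -map_cons perm_sym.
  by apply/perm_map/perm_to_rem; rewrite mem_enum.
have Dj : D 0 j \in s.
  rewrite -(perm_mem ps) map_f // (mem_rem_uniq _ (enum_uniq _)).
  by rewrite !inE ji0 mem_enum.
case: s ss {ps} Dj => [//|s1 s] /= /andP[_ /(order_path_min le_trans)/allP s1_le].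
by rewrite inE => /predU1P[->|/s1_le].
Qed.

(* The two-dimensional span of [w1] and [w2] contains a nonzero combination
   orthogonal to the eigenvector of the smallest eigenvalue. *)
Lemma second_eigenvalue_le {C : numClosedFieldType} {n : nat} (A : 'M[C]_n)
    (s : seq C) (w1 w2 : 'rV[C]_n) :
    A \is normalmx -> (1 < n)%N -> sorted <=%R s ->
    char_poly A = \prod_(a <- s) ('X - a%:P) ->
  exists a b : C, (a != 0) || (b != 0) /\
    let u := a *: w1 + b *: w2 in
    s`_1 * (u *m u^t*) 0 0 <= (u *m A *m u^t*) 0 0.
Proof.
move=> An n1 ss cp.
have [i0 le_s1] := spectral_diag_second_le An n1 ss cp.
have PU := spectral_unitarymx A.
move/orthomx_spectralP: An; rewrite invmx_unitary //.
set P := spectralmx A in PU *; set D := spectral_diag A in le_s1 * => AE.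
(* Coordinates of [u] in the orthonormal eigenbasis given by the rows of [P]. *)
pose coord u : 'rV[C]_n := u *m P^t*.
have [a [b [ab0 ab]]] : exists a b : C, (a != 0) || (b != 0) /\
    coord (a *: w1 + b *: w2) 0 i0 = 0.
  pose x := coord w1 0 i0; pose y := coord w2 0 i0.
  have coordE a b : coord (a *: w1 + b *: w2) 0 i0 = a * x + b * y.
    by rewrite /coord mulmxDl -!scalemxAl mxE [X in X + _]mxE [X in _ + X]mxE.
  (* The solution [(y, - x)] of [a * x + b * y = 0] is surely nonzero only when [y != 0]; otherwise
     [(0, 1)] serves. *)
  have [y0|y0] := eqVneq y 0.
    by exists 0, 1; rewrite oner_eq0 orbT coordE y0; split=> //; ring.
  by exists y, (- x); rewrite y0 coordE; split=> //; ring.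
exists a, b; split=> //=; set u := _ + _ in ab *.
have -> : u *m u^t* = coord u *m (coord u)^t*.
  by rewrite /coord trmx_mul map_mxM trmxCK mulmxA mulmxKtV.
have -> : u *m A *m u^t* = coord u *m diag_mx D *m (coord u)^t*.
  by rewrite /coord AE trmx_mul map_mxM trmxCK !mulmxA.
move: (coord u) ab => v vi0.
rewrite mul_mx_diag mxE [leRHS]mxE mulr_sumr; apply: ler_sum => j _.
rewrite !mxE mulrAC -normCK [leRHS]mulrC.
have [->|ji0] := eqVneq j i0; first by rewrite vi0 normr0 expr0n !mulr0.
by rewrite ler_wpM2r ?exprn_ge0 // le_s1.
Qed.

(** Since [S] and its complement are disjoint, each edge across the cut has exactly one orientation
    [(x, y)] starting in [S]. *)
Lemma card_edges_between (V : finType) (e : rel V) (S : {set V}) :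
    symmetric e ->
  #|edges_between e S (~: S)| = (\sum_(x in S) \sum_(y in ~: S) e x y)%N.
Proof.
move=> e_sym; pose D := [set p : V * V | [&& p.1 \in S, p.2 \in ~: S & e p.1 p.2]].
have -> : edges_between e S (~: S) = [set [set p.1; p.2] | p in D].
  apply/setP=> f; rewrite inE; apply/andP/imsetP.
    case; rewrite inE => /existsP[x /existsP[y /andP[exy /eqP fE]]].
    case/existsP=> x' /andP[x'S /existsP[y' /andP[y'S /eqP fE']]].
    exists (x', y') => //; rewrite inE x'S y'S /=.
    have : x' \in [set x; y] by rewrite -fE fE' set21.
    have : y' \in [set x; y] by rewrite -fE fE' set22.
    (* Two of the four matchings force [x' = y'], which is absurd; the swapped one is settled by
       symmetry of [e]. *)
    move: x'S y'S; rewrite !inE => x'S y'S /pred2P[] yE /pred2P[] xE.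
    - by rewrite -yE in xE; rewrite xE (negPf y'S) in x'S.
    - by rewrite xE yE e_sym.
    - by rewrite xE yE.
    - by rewrite -yE in xE; rewrite xE (negPf y'S) in x'S.
  case=> -[x y]; rewrite inE /= => /and3P[xS yS exy] ->; split.
    by rewrite inE; apply/existsP; exists x; apply/existsP; exists y;
       rewrite exy eqxx.
  by apply/existsP; exists x; rewrite xS; apply/existsP; exists y; rewrite yS /=.
rewrite card_in_imset => [|[x y] [x' y']]; last first.
  rewrite !inE /= => /and3P[xS yS _] /and3P[x'S y'S _] E.
  have : x \in [set x'; y'] by rewrite -E set21.
  have : y \in [set x'; y'] by rewrite -E set22.
  rewrite !inE => /pred2P[] yE /pred2P[] xE; subst => //.
  - by rewrite x'S in yS.
  - by rewrite x'S in yS.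
  - by rewrite xS in y'S.
rewrite pair_big_dep /= -sum1_card big_mkcond [RHS]big_mkcond /=.
apply: eq_bigr => -[x y] _; rewrite !inE /=.
by case: (x \in S) (y \in S) (e x y) => [] [] [].
Qed.

Lemma laplacian_mx_sym (R : rcfType) (V : finType) (e : rel V) :
  symmetric e -> (laplacian_mx R e)^T = laplacian_mx R e.
Proof.
move=> e_sym; apply/matrixP=> i j; rewrite !mxE e_sym eq_sym.
by have [->|] := eqVneq.
Qed.

(** Each column sums to zero: by symmetry the column of the adjacency matrix at a vertex sums to its
    degree. *)
Lemma mul_const_laplacian (R : rcfType) (V : finType) (e : rel V) (a : R) :
    symmetric e ->
  const_mx a *m laplacian_mx R e = 0 :> 'rV_#|V|.
Proof.
move=> e_sym; set L := laplacian_mx R e.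
apply/rowP=> j; rewrite !mxE.
transitivity (a * \sum_i L i j).
  by rewrite mulr_sumr; apply: eq_bigr => i _; rewrite mxE.
suff -> : \sum_i L i j = 0 by rewrite mulr0.
under eq_bigr do rewrite !mxE.
rewrite sumrB (bigD1 j) //= eqxx big1 => [|i /negPf->]; last by rewrite mulr0n.
rewrite addr0 mulr1n /degree -sum1_card natr_sum.
apply/eqP; rewrite subr_eq0; apply/eqP.
rewrite -(big_enum_val (fun x => (e x (enum_val j))%:R)) big_mkcond /=.
apply: eq_bigr => x _; rewrite inE e_sym.
by case: (e _ _).
Qed.

Definition indicator_row (R : rcfType) (V : finType) (S : {set V}) :
    'rV[R]_#|V| :=
  \row_i (enum_val i \in S)%:R.

(** A vertex [x] of [S] contributes its degree minus its number of neighbors in [S], that is, its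
    number of neighbors outside [S]. *)
Lemma laplacian_indicator (R : rcfType) (V : finType) (e : rel V)
    (S : {set V}) :
    symmetric e ->
  (indicator_row R S *m laplacian_mx R e *m (indicator_row R S)^T) 0 0
    = #|edges_between e S (~: S)|%:R.
Proof.
move=> e_sym; rewrite card_edges_between // mxE natr_sum.
(* Laplacian entries indexed by vertices instead of their ranks in the enumeration. *)
pose Lv x y : R := (degree e x)%:R *+ (x == y) - (e x y)%:R.
transitivity (\sum_(x in V) \sum_(y in V) (y \in S)%:R * Lv y x * (x \in S)%:R).
  rewrite [RHS]big_enum_val; apply: eq_bigr => i _.
  rewrite [RHS]big_enum_val !mxE mulr_suml; apply: eq_bigr => j _.
  by rewrite !mxE /Lv (inj_eq enum_val_inj).
rewrite [RHS]big_mkcond; apply: eq_bigr => x _.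
case: (boolP (x \in S)) => xS; last by rewrite big1 // => y _; rewrite mulr0.
rewrite -mulr_suml mulr1n mulr1; under [LHS]eq_bigr do rewrite /Lv mulrBr.
rewrite sumrB (bigD1 x) //= xS eqxx mul1r mulr1n.
rewrite big1 ?addr0 => [|y /negPf->]; last by rewrite mulr0n mulr0.
rewrite /degree -sum1_card natr_sum natr_sum !(big_mkcond (fun y => y \in _)) -sumrB.
apply: eq_bigr => y _; rewrite !inE (e_sym y x).
by case: (y \in S); case: (e x y); rewrite /= ?mulr1 ?mulr0 ?subrr ?subr0.
Qed.

Lemma dot_indicator (R : rcfType) (V : finType) (S : {set V}) (a b : R[i]) :
  let u := a *: const_mx 1 + b *: map_mx (real_complex R) (indicator_row R S) in
  (u *m u^t*) 0 0 = #|S|%:R * `|a + b| ^+ 2 + #|~: S|%:R * `|a| ^+ 2.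
Proof.
move=> u; rewrite mxE.
transitivity (\sum_(x in V) `|a + b * (x \in S)%:R| ^+ 2).
  rewrite [RHS]big_enum_val; apply: eq_bigr => i _.
  by rewrite !mxE normCK mulr1 rmorph_nat.
rewrite (bigID (fun x => x \in S)) /=; congr (_ + _).
  by rewrite (eq_bigr (fun=> `|a + b| ^+ 2)) => [|x ->];
     rewrite ?mulr1 // sumr_const mulr_natl.
rewrite (eq_bigr (fun=> `|a| ^+ 2)) => [|x /negPf->]; last by rewrite mulr0 addr0.
rewrite sumr_const mulr_natl; congr (_ *+ _).
by apply: eq_card => x; rewrite !inE.
Qed.

(** The constant part of [u] is killed on the left of the Laplacian and, by symmetry, on the right,
    so only [b * b^*] times the form at the indicator survives. *)
Lemma laplacian_span_indicator (R : rcfType) (V : finType) (e : rel V)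
    (S : {set V}) (a b : R[i]) :
    symmetric e ->
  let u := a *: const_mx 1 + b *: map_mx (real_complex R) (indicator_row R S) in
  (u *m map_mx (real_complex R) (laplacian_mx R e) *m u^t*) 0 0
    = `|b| ^+ 2 * #|edges_between e S (~: S)|%:R.
Proof.
move=> e_sym; set L := laplacian_mx R e; move=> u.
have c1 : const_mx 1 = map_mx (real_complex R) (const_mx 1) :> 'rV_#|V|.
  by rewrite map_const_mx rmorph1.
have L1 : map_mx (real_complex R) L *m (const_mx 1)^T = 0 :> 'cV_#|V|.
  rewrite c1 -[L]laplacian_mx_sym // !map_trmx -map_mxM -trmx_mul.
  by rewrite mul_const_laplacian // trmx0 map_mx0.
have uC : u^t* =
    a^* *: (const_mx 1)^T + b^* *: (map_mx (real_complex R) (indicator_row R S))^T.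
  by apply/matrixP => i j; rewrite !mxE rmorphD !rmorphM rmorph1 !rmorph_nat.
rewrite uC mulmxDr -!scalemxAr -mulmxA L1 mulmx0 scaler0 add0r.
rewrite mulmxDl -scalemxAl c1 -map_mxM mul_const_laplacian // map_mx0 scaler0 add0r.
rewrite -scalemxAl -map_mxM map_trmx -scalemxAl scalerA
  -map_mxM mxE [X in _ * X]mxE.
by rewrite laplacian_indicator // rmorph_nat mulrC normCK
  [in RHS]mulrC [b * _]mulrC.
Qed.

(** The theorem takes [S] to be the neighborhood of a vertex and divides by [n] and by
    [d (n - d)]. *)
Lemma cut_ge_second_eigenvalue (R : rcfType) (V : finType) (e : rel V)
    (S : {set V}) (lam : seq R) :
    symmetric e -> (2 <= #|V|)%N -> sorted_spectrum (laplacian_mx R e) lam ->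
  lam`_1 * (#|S|%:R * #|~: S|%:R) <= #|V|%:R * #|edges_between e S (~: S)|%:R.
Proof.
move=> e_sym V_ge2 [lam_sorted cp].
have [lam1_le0|lam1_gt0] := leP lam`_1 0.
  by apply: (@le_trans _ _ 0); rewrite ?mulr_ge0 // mulr_le0_ge0 // mulr_ge0.
set L := laplacian_mx R e in cp.
have normalL : map_mx (real_complex R) L \is normalmx.
  apply/normalmxP; have -> : (map_mx (real_complex R) L)^t* = map_mx (real_complex R) L.
    rewrite map_trmx laplacian_mx_sym //.
    apply/matrixP => i j; rewrite mxE [map_mx _ L i j]mxE.
    by apply: conj_Creal; apply/complex_realP; exists (L i j).
  by [].
have sorted_C : sorted <=%R [seq real_complex R a | a <- lam].
  by rewrite sorted_map; apply: sub_sorted lam_sorted => x y /=; rewrite lecR.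
have cp_C : char_poly (map_mx (real_complex R) L) =
    \prod_(a <- [seq real_complex R a | a <- lam]) ('X - a%:P).
  by rewrite big_map -map_char_poly cp map_prod_XsubC.
have [a [b [ab0]]] := second_eigenvalue_le (const_mx 1)
  (map_mx (real_complex R) (indicator_row R S)) normalL V_ge2 sorted_C cp_C.
have lam1E : [seq real_complex R a | a <- lam]`_1 = real_complex R lam`_1.
  (* Past the end of the list both sides are the default 0. *)
  have [lt|ge] := ltnP 1 (size lam); first exact: nth_map.
  by rewrite !nth_default ?size_map.
rewrite /= dot_indicator laplacian_span_indicator // lam1E.
set q := #|S|%:R; set p := #|~: S|%:R; set E := _%:R => rayleigh.
have nE : #|V|%:R = q + p by rewrite /q /p -natrD cardsC.
have lam1C_gt0 : 0 < real_complex R lam`_1 by rewrite -(rmorph0 (real_complex R)) ltcR.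
(* Splits [u] along the constants and their orthogonal complement: [q * (a + b) + p * a] is the sum
   of the entries of [u]. Dropping its square bounds the norm below. *)
have normE : (q + p) * (q * `|a + b| ^+ 2 + p * `|a| ^+ 2) =
    `|q * (a + b) + p * a| ^+ 2 + q * p * `|b| ^+ 2.
  rewrite !normCK !rmorphD !rmorphM rmorphD /= !rmorph_nat -/q -/p; ring.
have b_neq0 : b != 0.
  apply: contraTneq rayleigh => b0; move: ab0; rewrite b0 eqxx orbF => a0.
  rewrite normr0 expr0n /= mul0r addr0 -mulrDl -nE lt_geF //.
  by rewrite !mulr_gt0 ?exprn_gt0 ?normr_gt0 // ltr0n ltnW.
have b2_gt0 : 0 < `|b| ^+ 2 by rewrite exprn_gt0 ?normr_gt0.
rewrite -lecR !rmorphM !rmorph_nat -/q -/p -/E -(ler_pM2r b2_gt0).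
apply: (@le_trans _ _ (#|V|%:R * (`|b| ^+ 2 * E)));
  last by rewrite [leRHS]mulrAC mulrA.
apply: le_trans (ler_wpM2l (ler0n _ _) rayleigh).
by rewrite nE [leRHS]mulrCA normE -[leLHS]mulrA ler_wpM2l ?(ltW lam1C_gt0) //
  lerDr exprn_ge0.
Qed.

Theorem theorem4 (R : rcfType) (V : finType) (e : rel V)
    (e_sym : symmetric e) (e_irr : irreflexive e)
    (e_conn : connected_graph e) (V_ge2 : (2 <= #|V|)%N)
    (lam : seq R) (lamP : sorted_spectrum (laplacian_mx R e) lam) :
  (* lam is indexed from 0, so lambda_2 is lam`_1 *)
  (forall i : V, lam`_1 / #|V|%:R <= norm_ksi R e i) /\
  lam`_1 / #|V|%:R <= avg_norm_ksi R e.
Proof.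
have V_gt0 : 0 < #|V|%:R :> R by rewrite ltr0n ltnW.
have ksi_ge i : lam`_1 / #|V|%:R <= norm_ksi R e i.
  have cut := cut_ge_second_eigenvalue (neighbors e i) e_sym V_ge2 lamP.
  (* A path from [i] to some other vertex starts with a neighbor of [i]. *)
  have deg_gt0 : (0 < #|neighbors e i|)%N.
    have /card_gt0P[j] : (0 < #|[predD1 V & i]|)%N.
      by move: V_ge2; rewrite (cardD1 i).
    rewrite !inE andbT => ji; have /connectP[[|k s] /=] := e_conn i j.
      by move=> _ jE; rewrite jE eqxx in ji.
    by case/andP=> eik _ _; apply/card_gt0P; exists k; rewrite inE.
  (* The vertex [i] is not its own neighbor, so the denominator is positive. *)
  have codeg_gt0 : (0 < #|~: neighbors e i|)%N.
    by apply/card_gt0P; exists i; rewrite !inE e_irr.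
  have nE : #|V|%:R - (degree e i)%:R = #|~: neighbors e i|%:R :> R.
    by rewrite -(cardsC (neighbors e i)) natrD addrC addKr.
  rewrite /norm_ksi nE ler_pdivrMr // mulrAC ler_pdivlMr ?mulr_gt0 ?ltr0n //.
  by rewrite [leRHS]mulrC.
split=> //; rewrite /avg_norm_ksi [leRHS]mulrC ler_pdivlMr // mulr_natr.
by rewrite -sumr_const; apply: ler_sum.
Qed.
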